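(* Let $M$ be a smooth manifold equipped with a pseudo-Riemannian metric $g$ and with a Poisson structure $\Pi$ (no compatibility between $g$ and $\Pi$ is assumed). Let $S\subset M$ be a good symplectic leaf of $(M,\Pi)$ and let $G\in C^\infty(M)$. Then on $S$ the generalized double bracket vector field $\partial_{\mathcal M}G$ is the negative of the gradient vector field of $G|_S$ with respect to the double bracket metric $\tau^S_{\mathrm{DB}}$: $$(\partial_{\mathcal M}G)(x)=-\nabla_{\tau^S_{\mathrm{DB}}}(G|_S)(x),\qquad x\in S .$$
   Context: Conventions: $\sharp_\Pi\colon T^*M\to TM$ is defined by $\beta(\sharp_\Pi\alpha)=\Pi(\alpha,\beta)$, and the Hamiltonian vector field of $G$ is $X_G=\sharp_\Pi(\mathrm dG)$. The metriplectic tensor field is the symmetric contravariant 2-tensor field $\mathcal M(\alpha,\beta):=g(\sharp_\Pi\alpha,\sharp_\Pi\beta)$ for $\alpha,\beta\in\Omega^1(M)$, and $\sharp_{\mathcal M}\colon T^*M\to TM$ is defined by $\beta(\sharp_{\mathcal M}\alpha)=\mathcal M(\alpha,\beta)$. The generalized double bracket (GDB) vector field of $G\in C^\infty(M)$ is $\partial_{\mathcal M}G:=-i_{\mathrm dG}\mathcal M=-\sharp_{\mathcal M}(\mathrm dG)$; it is tangent to all symplectic leaves of $\Pi$. Let $S$ be a symplectic leaf of $\Pi$ with inclusion $\iota\colon S\hookrightarrow M$ (an injective immersion). Put $g^S_{\mathrm{ind}}:=\iota^*g$. The leaf $S$ is called a good symplectic leaf if $g^S_{\mathrm{ind}}$ is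 non-degenerate at every point of $S$. Let $\omega^S$ be the induced symplectic form on $S$, i.e. the symplectic form for which $\sharp_\Pi|_S=\iota_*\circ\sharp_{\omega^S}\circ\iota^*$, where $\sharp_{\omega^S}$ is the inverse of $\flat_{\omega^S}\colon TS\to T^*S$, $X\mapsto i_X\omega^S$ (the opposite sign convention for $\omega^S$ gives the same $\tau^S_{\mathrm{DB}}$). The double bracket (DB) metric on a good symplectic leaf $S$ is the pseudo-Riemannian metric $$\tau^S_{\mathrm{DB}}(X,Y):=(g^S_{\mathrm{ind}})^{-1}(i_X\omega^S,i_Y\omega^S),\qquad X,Y\in\mathfrak X(S),$$ where $(g^S_{\mathrm{ind}})^{-1}$ is the co-metric on $T^*S$ associated with $g^S_{\mathrm{ind}}$. For a pseudo-Riemannian metric $\tau$ on $S$ and $F\in C^\infty(S)$, the gradient $\nabla_\tau F$ is defined by $\tau(\nabla_\tau F,Y)=\mathrm dF(Y)$ for all $Y\in\mathfrak X(S)$. *)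

(* Defs.v *)
From HB Require Import structures.
From mathcomp Require Import all_boot all_order all_algebra.
From mathcomp Require Import all_classical all_reals all_analysis.

Set Implicit Arguments.
Unset Strict Implicit.
Unset Printing Implicit Defensive.

Import Order.TTheory GRing.Theory Num.Theory.
Import numFieldNormedType.Exports.

Local Open Scope classical_set_scope.
Local Open Scope ring_scope.

Section SmoothMaps.
Context {R : realType} {V W : normedModType R}.

(* [Ck k U f] is only meant for [U] open. *)
Fixpoint Ck (k : nat) (U : set V) (f : V -> W) : Prop :=
  if k is k'.+1 then
    (forall x, U x -> differentiable f x) /\
    (forall v, Ck k' U (fun x => 'D_v f x))
  else forall x, U x -> {for x, continuous f}.

Definition smooth_on (U : set V) (f : V -> W) := forall k, Ck k U f.

End SmoothMaps.

(* A chart is a homeomorphism between the open sets [chart_dom] and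
   [chart_img]; the values of [chart_fun] and [chart_inv] outside of these
   sets are irrelevant. *)
Record chart (R : realType) (T : topologicalType) (n : nat) := Chart {
  chart_dom : set T;
  chart_fun :> T -> 'rV[R]_n;
  chart_inv : 'rV[R]_n -> T;
  chart_dom_open : open chart_dom;
  chart_img_open : open (chart_fun @` chart_dom);
  chart_funK : forall x, chart_dom x -> chart_inv (chart_fun x) = x;
  chart_fun_cont : forall x, chart_dom x -> {for x, continuous chart_fun};
  chart_inv_cont :
    forall y, (chart_fun @` chart_dom) y -> {for y, continuous chart_inv} }.

Definition chart_img (R : realType) (T : topologicalType) (n : nat)
  (phi : chart R T n) : set 'rV[R]_n := phi @` chart_dom phi.

Record manifold (R : realType) := Manifold {
  points :> topologicalType;
  mdim : nat;
  atlas : set (chart R points mdim);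
  chart_at : points -> chart R points mdim;
  manifold_hausdorff : hausdorff_space points;
  manifold_second_countable : @second_countable points;
  chart_at_atlas : forall x, atlas (chart_at x);
  chart_at_dom : forall x, chart_dom (chart_at x) x;
  atlas_compatible : forall phi psi, atlas phi -> atlas psi ->
    smooth_on (phi @` (chart_dom phi `&` chart_dom psi))
              (psi \o chart_inv phi) }.

Section Manifolds.
Context {R : realType}.

(* A tangent vector at [x] is represented by its coordinates in the preferred
   chart [chart_at x] of the atlas around [x]. *)
Definition tangent (M : manifold R) (x : M) := 'rV[R]_(mdim M).

Definition cotangent (M : manifold R) (x : M) := 'Hom(tangent x, R^o).

Definition smooth_fun (M : manifold R) (f : M -> R) :=
  forall phi, atlas phi ->
    smooth_on (chart_img phi) (f \o chart_inv phi : _ -> R^o).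

Definition smooth_map (N M : manifold R) (f : N -> M) :=
  continuous f /\
  forall phi psi, atlas phi -> atlas psi ->
    smooth_on (phi @` (chart_dom phi `&` f @^-1` chart_dom psi))
              (psi \o f \o chart_inv phi).

Definition dfun (M : manifold R) (f : M -> R) (x : M) : cotangent x :=
  linfun ('d (f \o chart_inv (chart_at x) : _ -> R^o) (chart_at x x)).

Definition tangent_map (N M : manifold R) (f : N -> M) (x : N) :
    'Hom(tangent x, tangent (f x)) :=
  linfun ('d (chart_at (f x) \o f \o chart_inv (chart_at x)) (chart_at x x)).

(* The vectors d/dphi^i and the covectors dphi^i at a point [x] in the domain
   of the chart [phi]. *)
Definition frame (M : manifold R) (phi : chart R M (mdim M)) (x : M)
    (i : 'I_(mdim M)) : tangent x :=
  'd (chart_at x \o chart_inv phi) (phi x) (delta_mx 0 i).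

Definition coframe (M : manifold R) (phi : chart R M (mdim M)) (x : M)
    (i : 'I_(mdim M)) : cotangent x :=
  dfun (fun z => phi z 0 i) x.

(* A bilinear form on [V] is given by its flat map from [V] to the dual of
   [V]: the value of [B] at the pair (u, v) is [B u v], and the contraction
   i_u B is [B u]. *)
Definition covariant2 (M : manifold R) :=
  forall x : M, 'Hom(tangent x, cotangent x).

Definition contravariant2 (M : manifold R) :=
  forall x : M, 'Hom(cotangent x, 'Hom(cotangent x, R^o)).

Definition covariant2_coef (M : manifold R) (B : covariant2 M)
    (phi : chart R M (mdim M)) (i j : 'I_(mdim M)) (y : 'rV[R]_(mdim M)) : R^o :=
  let x := chart_inv phi y in B x (frame phi x i) (frame phi x j).

Definition contravariant2_coef (M : manifold R) (P : contravariant2 M)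
    (phi : chart R M (mdim M)) (i j : 'I_(mdim M)) (y : 'rV[R]_(mdim M)) : R^o :=
  let x := chart_inv phi y in P x (coframe phi x i) (coframe phi x j).

Definition smooth_covariant2 (M : manifold R) (B : covariant2 M) :=
  forall phi, atlas phi -> forall i j,
    smooth_on (chart_img phi) (covariant2_coef B phi i j).

Definition smooth_contravariant2 (M : manifold R) (P : contravariant2 M) :=
  forall phi, atlas phi -> forall i j,
    smooth_on (chart_img phi) (contravariant2_coef P phi i j).

Definition nondegenerate (V : vectType R) (B : 'Hom(V, 'Hom(V, R^o))) :=
  forall u, (forall v, B u v = 0) -> u = 0.

Definition pseudo_riemannian (M : manifold R) (g : covariant2 M) :=
  [/\ smooth_covariant2 g,
      forall x (u v : tangent x), g x u v = g x v u &
      forall x : M, nondegenerate (g x)].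

Definition poisson_bracket (M : manifold R) (Pi : contravariant2 M)
  (f h : M -> R) : M -> R := fun x => Pi x (dfun f x) (dfun h x).

Definition poisson (M : manifold R) (Pi : contravariant2 M) :=
  [/\ smooth_contravariant2 Pi,
      forall x (a b : cotangent x), Pi x a b = - Pi x b a &
      forall f h k : M -> R, smooth_fun f -> smooth_fun h -> smooth_fun k ->
        forall x, poisson_bracket Pi f (poisson_bracket Pi h k) x
                + poisson_bracket Pi h (poisson_bracket Pi k f) x
                + poisson_bracket Pi k (poisson_bracket Pi f h) x = 0].

(* In coordinates, (d omega)_{ijk} = d_i omega_{jk} + d_j omega_{ki}
   + d_k omega_{ij}. *)
Definition closed_form2 (M : manifold R) (om : covariant2 M) :=
  forall phi, atlas phi -> forall i j k y, chart_img phi y ->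
    'D_(delta_mx 0 i) (covariant2_coef om phi j k) y
  + 'D_(delta_mx 0 j) (covariant2_coef om phi k i) y
  + 'D_(delta_mx 0 k) (covariant2_coef om phi i j) y = 0.

Definition symplectic_form (M : manifold R) (om : covariant2 M) :=
  [/\ smooth_covariant2 om,
      forall x (u v : tangent x), om x u v = - om x v u,
      forall x : M, nondegenerate (om x) &
      closed_form2 om].

Definition sharp (V : vectType R)
    (B : 'Hom(V, R^o) -> 'Hom(V, R^o) -> R) (a : 'Hom(V, R^o)) : V :=
  xget 0 [set v | forall b : 'Hom(V, R^o), b v = B a b].

Definition poisson_sharp (M : manifold R) (Pi : contravariant2 M) (x : M)
  (a : cotangent x) : tangent x := sharp (fun a b => Pi x a b) a.

Definition metriplectic (M : manifold R) (g : covariant2 M)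
    (Pi : contravariant2 M) (x : M) (a b : cotangent x) : R :=
  g x (poisson_sharp Pi a) (poisson_sharp Pi b).

Definition gdb_field (M : manifold R) (g : covariant2 M)
    (Pi : contravariant2 M) (G : M -> R) (x : M) : tangent x :=
  - sharp (@metriplectic M g Pi x) (dfun G x).

Definition codual (V W : vectType R) (f : 'Hom(V, W)) :
    'Hom('Hom(W, R^o), 'Hom(V, R^o)) :=
  linfun (fun b : 'Hom(W, R^o) => (b \o f)%VF).

Definition pullback_covector (N M : manifold R) (f : N -> M) (s : N)
  (b : cotangent (f s)) : cotangent s := codual (tangent_map f s) b.

Definition pullback2 (N M : manifold R) (f : N -> M) (B : covariant2 M) :
    covariant2 N :=
  fun s => (codual (tangent_map f s) \o B (f s) \o tangent_map f s)%VF.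

Definition integral_manifold (M : manifold R) (Pi : contravariant2 M)
    (N : manifold R) (j : N -> M) :=
  [/\ [set: N] !=set0, connected [set: N], smooth_map j & injective j] /\
  forall s : N, injective (tangent_map j s) /\
    range (tangent_map j s) = range (@poisson_sharp M Pi (j s)).

(* The symplectic leaves are the maximal integral manifolds of the
   characteristic distribution. *)
Definition symplectic_leaf (M : manifold R) (Pi : contravariant2 M)
    (S : manifold R) (iota : S -> M) :=
  integral_manifold Pi iota /\
  forall (N : manifold R) (j : N -> M), integral_manifold Pi j ->
    range j `&` range iota !=set0 -> range j `<=` range iota.

Definition good_symplectic_leaf (M : manifold R) (g : covariant2 M)
    (Pi : contravariant2 M) (S : manifold R) (iota : S -> M) :=
  symplectic_leaf Pi iota /\ forall s : S, nondegenerate (pullback2 iota g s).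

Definition induced_symplectic_form (M : manifold R) (Pi : contravariant2 M)
    (S : manifold R) (iota : S -> M) (om : covariant2 S) :=
  symplectic_form om /\
  forall (s : S) (a : cotangent (iota s)),
    poisson_sharp Pi a
    = tangent_map iota s ((om s)^-1%VF (pullback_covector a)).

(* The bilinear form on the dual of [V] corresponding to the nondegenerate
   form [B] under the isomorphism [B]. *)
Definition cometric (V : vectType R) (B : 'Hom(V, 'Hom(V, R^o)))
  (a b : 'Hom(V, R^o)) : R := B (B^-1%VF a) (B^-1%VF b).

Definition double_bracket_metric (M : manifold R) (g : covariant2 M)
    (S : manifold R) (iota : S -> M) (om : covariant2 S)
    (s : S) (X Y : tangent s) : R :=
  cometric (pullback2 iota g s) (om s X) (om s Y).

Definition gradient (S : manifold R)
    (tau : forall s : S, tangent s -> tangent s -> R) (F : S -> R) (s : S) :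
    tangent s :=
  xget 0 [set v | forall Y : tangent s, tau s v Y = dfun F s Y].

End Manifolds.

(* Main.v *)
Require Import Defs.
From HB Require Import structures.
From mathcomp Require Import all_boot all_order all_algebra.
From mathcomp Require Import all_classical all_reals all_analysis.
Import GRing.Theory.
Local Open Scope ring_scope.

(* The statement is pointwise linear algebra plus the chain rule
   d(G o iota) = T^* dG, where T is the differential of iota.  Write h = T^* g T
   for the induced metric on the leaf.  Since the sharp map of Pi is
   T om^-1 T^*, that of the metriplectic tensor is - T om^-1 h om^-1 T^*, the
   sign coming from the skew-symmetry of om; on the other hand
   tau(X, Y) = h^-1(om X, om Y), as a flat map, is - om h^-1 om, whose inverse
   is - om^-1 h om^-1. *)

Set Implicit Arguments.
Unset Strict Implicit.
Unset Printing Implicit Defensive.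
Import Num.Theory numFieldNormedType.Exports.

(** Injectivity and equality of dimensions make the image full, so the left inverse is a right
    inverse too. *)
Lemma lker0_dim_lfunVK (K : fieldType) (aT rT : vectType K) (f : 'Hom(aT, rT)) :
  dim aT = dim rT -> lker f == 0%VS -> cancel f^-1%VF f.
Proof.
move=> eq_dim kerf0 u; apply: limg_lfunVK.
suff -> : limg f = fullv by exact: memvf.
apply/eqP; rewrite eqEdim subvf limg_dim_eq; last by rewrite (eqP kerf0) capv0.
by rewrite !dimvf eq_dim leqnn.
Qed.

(** The coordinate functionals of a basis already separate vectors. *)
Lemma eq_dual (K : fieldType) (V : vectType K) (v w : V) :
  (forall b : 'Hom(V, K^o), b v = b w) -> v = w.
Proof.
move=> eq_vw.
rewrite (coord_vbasis (memvf v)) (coord_vbasis (memvf w)).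
apply: eq_bigr => i _; congr (_ *: _).
by have := eq_vw (linfun (coord (vbasis fullv) i : V -> K^o)); rewrite !lfunE.
Qed.

Section LinearAlgebra.
Context {R : realType}.

Lemma sharpE (V : vectType R) (B : 'Hom(V, R^o) -> 'Hom(V, R^o) -> R)
    (a : 'Hom(V, R^o)) (v : V) :
  (forall b : 'Hom(V, R^o), b v = B a b) -> sharp B a = v.
Proof.
move=> vB; apply: xget_unique => // w wB.
by apply: eq_dual => b; rewrite wB vB.
Qed.

Lemma nondegenerate_ker (V : vectType R) (B : 'Hom(V, 'Hom(V, R^o))) :
  Defs.nondegenerate B -> lker B == 0%VS.
Proof.
move=> nB; rewrite -subv0; apply/subvP => u; rewrite memv_ker memv0 => /eqP Bu0.
by apply/eqP/nB => v; rewrite Bu0 lfunE.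
Qed.

Lemma nondegenerateK (V : vectType R) (B : 'Hom(V, 'Hom(V, R^o))) :
  Defs.nondegenerate B -> cancel B B^-1%VF.
Proof. by move=> /nondegenerate_ker /lker0_lfunK. Qed.

Lemma nondegenerateVK (V : vectType R) (B : 'Hom(V, 'Hom(V, R^o))) :
  Defs.nondegenerate B -> cancel B^-1%VF B.
Proof.
move=> /nondegenerate_ker; apply: lker0_dim_lfunVK.
(* The dual of [V] has dimension [dim V * 1]. *)
by rewrite [RHS]muln1.
Qed.

Lemma codualE (V W : vectType R) (f : 'Hom(V, W)) (b : 'Hom(W, R^o)) (v : V) :
  codual f b v = b (f v).
Proof.
have lin : linear (fun b : 'Hom(W, R^o) => (b \o f)%VF).
  by move=> k b1 b2; rewrite comp_lfunDl comp_lfunZl.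
(* [codual] applies [linfun] to a bare function; [lfunE] computes it once that function carries its
   linear structure. *)
pose m := GRing.isLinear.Build _ _ _ _ _ lin.
pose F : {linear _ -> _} := HB.pack (fun b : 'Hom(W, R^o) => (b \o f)%VF) m.
by rewrite (_ : codual f = linfun F) // !lfunE.
Qed.

Section DoubleBracket.
Variables (V W : vectType R) (T : 'Hom(W, V)).
Variables (g : 'Hom(V, 'Hom(V, R^o))) (om : 'Hom(W, 'Hom(W, R^o))).
Hypothesis g_sym : forall u v, g u v = g v u.
Hypothesis om_skew : forall u v, om u v = - om v u.
Hypothesis om_nondegenerate : Defs.nondegenerate om.

Let h : 'Hom(W, 'Hom(W, R^o)) := (codual T \o g \o T)%VF.
Hypothesis h_nondegenerate : Defs.nondegenerate h.

(** The inverse of the flat map of tau, applied to the restricted covector T^* a. *)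
Definition double_bracket_gradient (a : 'Hom(V, R^o)) : W :=
  - om^-1%VF (h (om^-1%VF (codual T a))).

Lemma double_bracket_gradientP (a : 'Hom(V, R^o)) (Y : W) :
  cometric h (om (double_bracket_gradient a)) (om Y) = codual T a Y.
Proof.
have h_sym u v : h u v = h v u by rewrite !comp_lfunE !codualE g_sym.
rewrite /cometric nondegenerateVK // /double_bracket_gradient linearN /=.
(* Symmetry brings h^-1 (om Y) into the first slot of h, where it cancels to om Y; skew-symmetry of
   om then absorbs the minus sign. *)
rewrite nondegenerateVK // opp_lfunE h_sym nondegenerateVK //.
by rewrite om_skew opprK nondegenerateVK.
Qed.

Lemma double_bracket_gradient_unique (a : 'Hom(V, R^o)) (v : W) :
  (forall Y, cometric h (om v) (om Y) = codual T a Y) ->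
  v = double_bracket_gradient a.
Proof.
move=> vP; apply: (can_inj (nondegenerateK om_nondegenerate)).
apply/lfunP => u.
(* For this Y one has h^-1 (om Y) = u, so the pairing with v reduces to om v u. *)
have := vP (om^-1%VF (h u)); rewrite -double_bracket_gradientP /cometric.
by rewrite !(nondegenerateVK om_nondegenerate) !nondegenerateVK // nondegenerateK.
Qed.

(** With T om^-1 T^* as the sharp map of Pi, the right-hand side is the metriplectic tensor at (a,
    b). *)
Lemma double_bracket_gradient_sharp (a b : 'Hom(V, R^o)) :
  b (T (double_bracket_gradient a))
  = g (T (om^-1%VF (codual T a))) (T (om^-1%VF (codual T b))).
Proof.
rewrite -codualE -[codual T b in LHS](nondegenerateVK om_nondegenerate).
rewrite om_skew /double_bracket_gradient linearN /= opp_lfunE opprK.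
by rewrite nondegenerateVK // !comp_lfunE codualE.
Qed.

End DoubleBracket.
End LinearAlgebra.

Section ChainRule.
Context {R : realType}.

(** ['d] is chosen by [get] among the continuous linear maps giving a first-order expansion. This
    condition depends only on the germ at x, so both choices coincide, even without
    differentiability. *)
Lemma near_eq_diff (V W : normedModType R) (f k : V -> W) (x : V) :
  (\forall y \near x, f y = k y) -> 'd f x = 'd k x :> (V -> W).
Proof.
move=> fk.
have sub (f1 f2 : V -> W) (df : {linear V -> W}) :
    (\forall y \near x, f1 y = f2 y) ->
    (forall y, f1 y = f1 (lim (nbhs x)) + df (y - lim (nbhs x))
      +o_(y \near x) (y - lim (nbhs x))) ->
    forall y, f2 y = f2 (lim (nbhs x)) + df (y - lim (nbhs x))
      +o_(y \near x) (y - lim (nbhs x)).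
  move=> eq12 o1.
  pose e y := y - lim (nbhs x).
  pose l (f : V -> W) y := f (lim (nbhs x)) + df (e y).
  have /eqaddoP {}o1 : f1 = l f1 +o_x e by apply/funext.
  suff : f2 = l f2 +o_x e by rewrite funeqE.
  apply/eqaddoP => eps eps_gt0; have := o1 _ eps_gt0.
  have lim_x : lim (nbhs x) = x by apply: cvg_lim.
  rewrite /l lim_x -(nbhs_singleton eq12).
  apply: filterS2 eq12 => y eq12y.
  by rewrite !fctE eq12y.
rewrite /diff; congr (_ (get _)); apply/funext => df; apply/propext.
split=> -[dfc o]; split=> //; [exact: sub fk o|apply: sub o].
by apply: filterS fk.
Qed.

Lemma smooth_on_differentiable (V W : normedModType R) (U : set V) (f : V -> W)
    (x : V) : smooth_on U f -> U x -> differentiable f x.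
Proof. by move=> /(_ 1%N) [+ _] => /[apply]. Qed.

Lemma dfun_comp (M N : manifold R) (f : N -> M) (G : M -> R) (s : N) :
  smooth_map f -> smooth_fun G ->
  dfun (G \o f) s = codual (tangent_map f s) (dfun G (f s)).
Proof.
move=> [f_cont f_smooth] G_smooth.
set phi := chart_at s; set psi := chart_at (f s).
have s_phi : chart_dom phi s by exact: chart_at_dom.
have fs_psi : chart_dom psi (f s) by exact: chart_at_dom.
have phiK : chart_inv phi (phi s) = s by exact: chart_funK.
apply/lfunP => v; rewrite codualE !lfunE.
pose F := psi \o f \o chart_inv phi.
pose H : _ -> R^o := G \o chart_inv psi.
have F_phi : F (phi s) = psi (f s) by rewrite /F /= phiK.
have dF : differentiable F (phi s).
  apply: (smooth_on_differentiable (f_smooth _ _ (chart_at_atlas _)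
    (chart_at_atlas _))).
  by exists s.
have dH : differentiable H (F (phi s)).
  apply: (smooth_on_differentiable (G_smooth _ (chart_at_atlas _))).
  by rewrite F_phi; exists (f s).
transitivity (('d H (F (phi s)) \o 'd F (phi s)) v); last first.
  by rewrite F_phi.
rewrite -diff_comp //.
(* The two coordinate expressions need only agree near [phi s]: inserting psi^-1 psi is harmless
   where f o phi^-1 lands in the domain of psi, which holds nearby by continuity. *)
apply: (congr1 (fun k => k v)); apply: near_eq_diff.
have inv_cont : {for phi s, continuous (chart_inv phi)}.
  by apply: chart_inv_cont; exists s.
have cont : {for phi s, continuous (f \o chart_inv phi)}.
  by apply: continuous_comp => //; apply: f_cont.
have : \forall y \near phi s, chart_dom psi (f (chart_inv phi y)).
  apply: cont; rewrite /= phiK.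
  by apply: open_nbhs_nbhs; split=> //; exact: chart_dom_open.
by apply: filterS => y psi_y; rewrite /H /F /= chart_funK.
Qed.

End ChainRule.

Theorem theorem3p4 (R : realType) (M : manifold R)
    (g : covariant2 M) (Pi : contravariant2 M)
    (hg : pseudo_riemannian g) (hPi : poisson Pi)
    (S : manifold R) (iota : S -> M)
    (hS : good_symplectic_leaf g Pi iota)
    (om : covariant2 S) (hom : induced_symplectic_form Pi iota om)
    (G : M -> R) (hG : smooth_fun G) (s : S) :
  gdb_field g Pi G (iota s)
  = tangent_map iota s
      (- gradient (double_bracket_metric g iota om) (G \o iota) s).
Proof.
have [_ g_sym _] := hg.
have [[[[_ _ iota_smooth _] _] _] h_nondegenerate] := hS.
have [[_ om_skew om_nondegenerate _] om_sharp] := hom.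
pose a := dfun G (iota s).
pose w := double_bracket_gradient (tangent_map iota s) (g (iota s)) (om s) a.
have -> : gradient (double_bracket_metric g iota om) (G \o iota) s = w.
  rewrite /gradient dfun_comp //; apply: xget_unique => [Y|v vP].
    exact: (double_bracket_gradientP (g_sym _) (om_skew s)
      (om_nondegenerate s) (h_nondegenerate s)).
  exact: (double_bracket_gradient_unique (g_sym _) (om_skew s)
    (om_nondegenerate s) (h_nondegenerate s)).
(* The minus signs on both sides cancel; what remains is that T w represents the metriplectic
   contraction of dG, tested on a covector b. *)
rewrite linearN /gdb_field; congr (- _); apply: sharpE => b.
rewrite (double_bracket_gradient_sharp _ _ (om_skew s)) // /metriplectic.
by rewrite !om_sharp.
Qed.
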